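(* There is an absolute constant $C>0$ such that for every integer $n\ge 2$, every $\delta>0$, and every $2$-LCS $\mathcal S$ on $[n]$ with error-tolerance $\delta$, we have $\mathrm{rank}(\mathcal S)\le C\cdot\frac{1}{\delta}\log_2 n$.
   Context: A spanoid $\mathcal S$ on $[n]=\{1,\dots,n\}$ is a family of pairs $(S,i)$ with $S\subseteq[n]$, $i\in[n]$ (called rules, written $S\to i$). For $T\subseteq[n]$ and $i\in[n]$ write $T\models i$ if there is a sequence $T=T_0,T_1,\dots,T_r$ ($r\ge 0$) with $i\in T_r$ such that for each $j\in[r]$, $T_j=T_{j-1}\cup\{i_j\}$ for some $i_j\in[n]$ for which there is $S\subseteq T_{j-1}$ with $(S,i_j)\in\mathcal S$. The span of $T$ is $\mathrm{span}(T)=\{i: T\models i\}$, and $\mathrm{rank}(\mathcal S)$ is the minimum size of a set $T\subseteq[n]$ with $\mathrm{span}(T)=[n]$. A spanoid $\mathcal S$ on $[n]$ is a $q$-LCS with error-tolerance $\delta$ if for every $i\in[n]$ there is a family $M_i$ of at least $\delta n$ pairwise disjoint $q$-element subsets of $[n]$ such that $(S,i)\in\mathcal S$ for every $S\in M_i$. *)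

(* Defs.v *)
From mathcomp Require Import all_boot all_order all_algebra.
From mathcomp Require Import boolp reals exp.
Set Implicit Arguments.
Unset Strict Implicit.
Unset Printing Implicit Defensive.
Import Order.TTheory GRing.Theory Num.Theory.

Local Open Scope ring_scope.

(* The ground set [n] is 'I_n; the rule X -> i is the pair (X, i). *)
Definition spanoid (n : nat) := {set {set 'I_n} * 'I_n}.

Section Spanoid.
Variables (n : nat) (S : spanoid n).
Implicit Types (T A B X : {set 'I_n}) (i : 'I_n).

Definition spanoid_step : rel {set 'I_n} := fun A B =>
  [exists i, [exists X : {set 'I_n},
    [&& X \subset A, (X, i) \in S & B == i |: A]]].

(* The sequence p is T_1, ..., T_r; it may be empty, and then last T p is T. *)
Definition derives T i : Prop :=
  exists p : seq {set 'I_n}, path spanoid_step T p /\ i \in last T p.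

Definition span T : {set 'I_n} := [set i | `[< derives T i >]].

Definition spanning T : bool := span T == [set: 'I_n].

Lemma spanningT : spanning [set: 'I_n].
Proof.
apply/eqP/setP => i; rewrite !inE; apply/asboolP.
by exists [::]; rewrite /= inE.
Qed.

(* By spanningT, the default value setT does satisfy the minimised predicate;
   see rankP. *)
Definition rank : nat :=
  #|[arg min_(T < [set: 'I_n] | spanning T) #|T| ]|.

Lemma rankP :
  (exists2 T, spanning T & #|T| = rank) /\
  (forall T, spanning T -> (rank <= #|T|)%N).
Proof.
rewrite /rank; case: arg_minnP => [|T spT minT]; first exact: spanningT.
by split; first exists T.
Qed.

Definition is_LCS (R : realType) (q : nat) (delta : R) : Prop :=
  forall i, exists M : {set {set 'I_n}},
    [/\ delta * n%:R <= #|M|%:R,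
        trivIset M,
        forall X, X \in M -> #|X| = q
      & forall X, X \in M -> (X, i) \in S].

End Spanoid.

Definition log2 (R : realType) (x : R) : R := ln x / ln 2.

(* Main.v *)
Require Import Defs.
From mathcomp Require Import all_boot all_order all_algebra.
From mathcomp Require Import boolp reals exp.
From mathcomp Require Import ring lra.
Import Order.TTheory GRing.Theory Num.Theory.
Local Open Scope ring_scope.
Set Implicit Arguments.
Unset Strict Implicit.
Unset Printing Implicit Defensive.

Local Notation span := Defs.span.

(** Build a spanning set greedily. Maintain a set [A] of chosen elements and a
    set [D] such that every element outside [span A] lies in [span (d |: A)] for
    some [d] in [D]. If adding some [r] enlarges [span A] by [delta n / 2]
    elements, add it: this happens at most [2 / delta] times. Otherwise, for
    each [r] in [D] at least [delta n / 2] elements [a] lie in a rule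
    [{a, b} -> r] where [b] is not newly spanned by adding [r]. By averaging,
    some [a] serves a fraction [delta / 2] of [D] at once; after adding [a],
    each [r] it serves is either spanned or spanned by another element of [D],
    and an irredundant part of [D] has size at most [(1 - delta / 4) #|D|].
    This happens at most [1 + (4 / delta) ln n] times. *)

(** * Span as a closure operator *)

Section Span.
Variables (n : nat) (S : spanoid n).
Implicit Types (A B X T D : {set 'I_n}) (i a b d r s : 'I_n).

Lemma derivesP A i :
  reflect (exists2 T, connect (spanoid_step S) A T & i \in T) (i \in span S A).
Proof.
rewrite inE; apply: (iffP (asboolP _)) => [[p [pth ip]]|[T /connectP[p pth ->] iT]].
  by exists (last A p) => //; apply/connectP; exists p.
by exists p.
Qed.

Lemma connect_step_widen A B T : A \subset B -> connect (spanoid_step S) A T ->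
  exists2 T', connect (spanoid_step S) B T' & T \subset T'.
Proof.
move=> + /connectP[p pth ->] {T}; elim: p A B pth => [|C p IH] A B /=.
  by move=> _ sAB; exists B.
case/andP=> /existsP[i /existsP[X /and3P[sXA XiS /eqP->]]] pth sAB.
have [T' cT' sT'] := IH _ (i |: B) pth (setUS _ sAB).
exists T' => //; apply: connect_trans cT'; apply: connect1.
apply/existsP; exists i; apply/existsP; exists X.
by rewrite (subset_trans sXA sAB) XiS eqxx.
Qed.

Lemma sub_span A : A \subset span S A.
Proof. by apply/subsetP => i iA; apply/derivesP; exists A. Qed.

Lemma connect_sub A T : connect (spanoid_step S) A T -> A \subset T.
Proof.
case/connectP=> p + -> {T}; elim: p A => //= C p IH A.
case/andP=> /existsP[i /existsP[X /and3P[_ _ /eqP->]]] /IH.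
exact/subset_trans/subsetU1.
Qed.

(* A reachable set of maximal size absorbs every other derivation. *)
Lemma connect_span A : connect (spanoid_step S) A (span S A).
Proof.
case: (@arg_maxnP _ A (connect (spanoid_step S) A) (fun T => #|T|)) => // T cT maxT.
suff -> : span S A = T by [].
apply/eqP; rewrite eqEsubset; apply/andP; split; apply/subsetP=> i; last first.
  by move=> iT; apply/derivesP; exists T.
case/derivesP=> U cU iU.
have [T' cT' sUT'] := connect_step_widen (connect_sub cT) cU.
have /eqP -> : T == T'.
  rewrite eqEcard (connect_sub cT'); apply: maxT; exact: connect_trans cT'.
exact: (subsetP sUT').
Qed.

Lemma span_rule A X i : X \subset span S A -> (X, i) \in S -> i \in span S A.
Proof.
move=> sX XiS; apply/derivesP; exists (i |: span S A); last exact: setU11.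
apply: connect_trans (connect_span A) (connect1 _).
by apply/existsP; exists i; apply/existsP; exists X; rewrite sX XiS eqxx.
Qed.

Lemma span_sub A B : A \subset span S B -> span S A \subset span S B.
Proof.
move=> sAB; apply/subsetP=> i /derivesP[T /connectP[p + ->] {T}].
elim: p A sAB => [|C p IH] A sAB /=; first by move=> _; exact: (subsetP sAB).
case/andP=> /existsP[j /existsP[X /and3P[sXA XjS /eqP->]]]; apply: IH.
rewrite subUset sAB andbT sub1set.
exact: span_rule (subset_trans sXA sAB) XjS.
Qed.

Lemma spanS A B : A \subset B -> span S A \subset span S B.
Proof. by move=> sAB; apply: span_sub; apply: subset_trans (sub_span B). Qed.

(** Over a fixed [A], being spanned by one extra element is a preorder; exchanging elements of a
    covering set rests on its transitivity. *)
Lemma mem_span_trans A r s i :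
  r \in span S (s |: A) -> i \in span S (r |: A) -> i \in span S (s |: A).
Proof.
move=> rs; apply/subsetP/span_sub; rewrite subUset sub1set rs.
exact: subset_trans (subsetUr _ _) (sub_span _).
Qed.

(** * Covering sets and their irredundant parts *)

Definition covers A D : bool :=
  [forall i, (i \in span S A) || [exists d in D, i \in span S (d |: A)]].

Lemma coversP A D :
  reflect (forall i, i \notin span S A -> exists2 d, d \in D & i \in span S (d |: A))
          (covers A D).
Proof.
apply: (iffP forallP) => [cov i iA|cov i].
  by move: (cov i); rewrite (negPf iA) => /exists_inP.
by case: (boolP (i \in _)) => //= /cov ?; apply/exists_inP.
Qed.

Lemma covers_setT : covers set0 [set: 'I_n].
Proof.
by apply/coversP => i _; exists i => //; apply: (subsetP (sub_span _)); rewrite setU11.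
Qed.

Lemma coversS A B D : A \subset B -> covers A D -> covers B D.
Proof.
move=> sAB /coversP cov; apply/coversP => i iB.
have /cov[d dD id] : i \notin span S A by apply: contra iB; exact/subsetP/spanS.
by exists d => //; apply: (subsetP (spanS (setUS _ sAB))).
Qed.

Lemma covers_set0 A : covers A set0 -> spanning S A.
Proof.
move=> /coversP cov; apply/eqP/setP=> i; rewrite [RHS]inE.
by apply/negbNE/negP => /cov[d]; rewrite inE.
Qed.

Lemma covers_setD1 A D r :
  covers A D ->
  (r \in span S A \/ exists2 s, s \in D :\ r & r \in span S (s |: A)) ->
  covers A (D :\ r).
Proof.
move=> /coversP cov Hr; apply/coversP=> i iA.
have [d dD id] := cov i iA.
case: (eqVneq d r) => [dr|dr]; last by exists d => //; rewrite !inE dr.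
case: Hr => [rA|[s sD rs]]; last by exists s => //; apply: mem_span_trans rs _; rewrite -dr.
case/negP: iA; apply: subsetP id; apply: span_sub.
by rewrite subUset sub1set dr rA sub_span.
Qed.

(** Let [E] be a minimal covering subset of [D]. An [r] in both [H] and [E] is spanned through some
    [s] outside [E], and from [E] only [r] can cover [s]. So [r] and [s] span each other over [A],
    which makes the choice of [s] injective in [r]. Hence [H :&: E] and [H :\: E] each have at most
    [#|D :\: E|] elements. *)
Lemma covers_shrink A D (H : {set 'I_n}) :
  H \subset D -> covers A D ->
  (forall r, r \in H ->
     r \in span S A \/ exists2 s, s \in D :\ r & r \in span S (s |: A)) ->
  exists2 D', covers A D' & (2 * #|D'| + #|H| <= 2 * #|D|)%N.
Proof.
move=> sHD covD Hred.
pose P D' := (D' \subset D) && covers A D'.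
case: (@arg_minnP _ D P (fun D' => #|D'|)); first by rewrite /P subxx.
move=> E /andP[sED covE] minE; exists E => //.
have irred r : r \in E ->
    ~ (r \in span S A \/ exists2 s, s \in E :\ r & r \in span S (s |: A)).
  move=> rE /(covers_setD1 covE) cov.
  have /minE : P (E :\ r) by rewrite /P cov (subset_trans (subD1set _ _) sED).
  by rewrite [X in (X <= _)%N](cardsD1 r) rE add1n ltnn.
have partner r : exists s, r \in H :&: E ->
    [/\ s \in D :\: E, r \in span S (s |: A) & s \in span S (r |: A)].
  (* Outside [H :&: E] the implication is vacuous and [r] is a dummy witness. *)
  case: (boolP (r \in _)) => [/setIP[rH rE]|_]; last by exists r.
  have [rA|[s /setD1P[sr sD] rs]] := Hred r rH; first by case: (irred r rE); left.
  exists s => _.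
  have sE : s \notin E.
    by apply/negP => sE; case: (irred r rE); right; exists s => //; rewrite !inE sr.
  split=> //; first by rewrite inE sE.
  have sA : s \notin span S A.
    apply/negP => sA; case: (irred r rE); left; apply: subsetP rs.
    by apply: span_sub; rewrite subUset sub1set sA sub_span.
  have /coversP/(_ s sA)[d dE sd] := covE.
  (* A [d] other than [r] would span [s], hence [r], making [r] redundant in [E]. *)
  case: (eqVneq d r) => [<- //|dr]; case: (irred r rE); right.
  by exists d; [rewrite !inE dr | exact: mem_span_trans sd rs].
have [f fP] := choice partner.
have f_inj : {in H :&: E &, injective f}.
  move=> r r' rHE r'HE ff; apply/eqP/negP => /negP rr'.
  have [_ rf _] := fP r rHE; have [_ _ fr'] := fP r' r'HE.
  have /setIP[_ rE] := rHE; have /setIP[_ r'E] := r'HE.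
  case: (irred r rE); right; exists r'; first by rewrite !inE eq_sym rr'.
  by apply: mem_span_trans fr' _; rewrite -ff.
have leHE : (#|H :&: E| <= #|D :\: E|)%N.
  rewrite -(card_in_imset f_inj); apply/subset_leq_card/subsetP => _ /imsetP[r rHE ->].
  by have [] := fP r rHE.
have leHD : (#|H :\: E| <= #|D :\: E|)%N by apply/subset_leq_card/setSD.
rewrite -(cardsID E H) -(cardsID E D) (setIidPr sED) mulnDr leq_add2l mul2n -addnn.
exact: leq_add.
Qed.

End Span.

(** * Counting: disjoint sets and averaging *)

Lemma trivIset_card_le (T : finType) (M : {set {set T}}) (Y : {set T}) :
  trivIset M -> (forall X, X \in M -> X :&: Y != set0) -> (#|M| <= #|Y|)%N.
Proof.
move=> triv meet.
(* Values in [option T] avoid the need for a default point, since [T] may be empty. *)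
have [f fP] : exists f : {set T} -> option T,
    forall X, X \in M -> exists2 y, f X = Some y & y \in X :&: Y.
  exists (fun X => [pick y in X :&: Y]) => X XM.
  case: pickP => [y yXY|/= none]; first by exists y.
  by case/set0Pn: (meet X XM) => y; rewrite none.
have f_inj : {in M &, injective f}.
  move=> X X' XM X'M ff; apply/eqP/negP => /negP XX'.
  have [y fy /setIP[yX _]] := fP X XM.
  have [y' fy' /setIP[yX' _]] := fP X' X'M.
  have yy' : y = y' by move: fy; rewrite ff fy' => -[].
  have /trivIsetP/(_ X X' XM X'M XX') := triv.
  by move/disjointFr/(_ yX); rewrite yy' yX'.
rewrite -(card_in_imset f_inj) -(card_imset Y (@Some_inj _)).
apply/subset_leq_card/subsetP => _ /imsetP[X XM ->].
have [y -> /setIP[_ yY]] := fP X XM; exact: imset_f.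
Qed.

(** Double counting of the pairs with [e a r]. The point [t0] makes [T] nonempty, so that strict
    bounds on all rows would stay strict when summed. *)
Lemma exists_dense_row (K : realFieldType) (T U : finType) (D : {set U})
    (e : T -> U -> bool) (c : K) (t0 : T) :
  (forall r, r \in D -> c * #|T|%:R <= #|[set a | e a r]|%:R) ->
  exists a, c * #|D|%:R <= #|[set r in D | e a r]|%:R.
Proof.
move=> dense.
have T_gt0 : 0 < #|T|%:R :> K by rewrite ltr0n; apply/card_gt0P; exists t0.
case: (pselect (exists a, c * #|D|%:R <= #|[set r in D | e a r]|%:R :> K)) => // none.
have sparse a : #|[set r in D | e a r]|%:R < c * #|D|%:R :> K.
  by rewrite ltNge; apply/negP => ?; apply: none; exists a.
have dbl : (\sum_(r in D) #|[set a | e a r]| = \sum_a #|[set r in D | e a r]|)%N.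
  transitivity (\sum_(r in D) \sum_a e a r)%N.
    apply: eq_bigr => r _; rewrite -sum1dep_card big_mkcond.
    by apply: eq_bigr => a _; case: (e a r).
  rewrite exchange_big; apply: eq_bigr => a _.
  rewrite -sum1dep_card big_mkcondr.
  by apply: eq_bigr => r _; case: (e a r).
have lo : #|D|%:R * (c * #|T|%:R) <= (\sum_(r in D) #|[set a | e a r]|)%:R :> K.
  rewrite natr_sum mulr_natl -sumr_const; exact: ler_sum.
have hi : (\sum_a #|[set r in D | e a r]|)%:R < #|T|%:R * (c * #|D|%:R) :> K.
  rewrite natr_sum mulr_natl -sumr_const.
  by apply: ltr_sum => //; apply/hasP; exists t0; rewrite ?mem_index_enum.
move: hi; rewrite -dbl => /(le_lt_trans lo).
by rewrite mulrCA [X in _ < X]mulrCA [#|T|%:R * _]mulrC ltxx.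
Qed.

(** * The greedy construction in a 2-LCS *)

Section LCS.
Variables (R : realType) (n : nat) (S : spanoid n) (delta : R).
Hypotheses (n_gt0 : (0 < n)%N) (delta_gt0 : 0 < delta) (lcs : is_LCS S 2 delta).
Implicit Types (A D : {set 'I_n}) (a b d r : 'I_n).

Lemma LCS_delta_le1 : delta <= 1.
Proof.
have [M [leM triv card2 _]] := lcs (Ordinal n_gt0).
have: (#|M| <= #|[set: 'I_n]|)%N.
  apply: trivIset_card_le => // X XM.
  by rewrite setIT -card_gt0 card2.
rewrite cardsT card_ord -(ler_nat R) => /(le_trans leM).
by rewrite -[X in _ <= X]mul1r ler_pM2r // ltr0n.
Qed.

(** Let [C] be the newly spanned set and [G] the set of helpers [a]. A rule set [{a, b}] for [r]
    meets [C] if [b] is in [C], and otherwise has [a] in [G]. Disjointness gives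
    [delta * n <= #|G| + #|C|], and [C] accounts for less than half. *)
Lemma LCS_many_helpers A r :
  #|span S (r |: A) :\: span S A|%:R < delta * n%:R / 2 ->
  delta / 2 * #|'I_n|%:R <=
    #|[set a | [exists b, (([set a; b], r) \in S) &&
                          (b \notin span S (r |: A) :\: span S A)]]|%:R.
Proof.
set C := _ :\: _; set G := [set a | _] => light.
have [M [leM triv card2 MS]] := lcs r.
have leGC : (#|M| <= #|G| + #|C|)%N.
  apply: leq_trans (leq_card_setU G C); apply: trivIset_card_le => // X XM.
  have /eqP/cards2P[a [b [ab eX]]] := card2 X XM.
  apply/set0Pn; case: (boolP (b \in C)) => bC.
    by exists b; rewrite eX !inE eqxx orbT; move: bC; rewrite !inE => ->; rewrite orbT.
  exists a; rewrite inE eX setU11 /= inE; apply/orP; left.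
  by rewrite inE; apply/existsP; exists b; rewrite bC -eX MS.
move: leGC; rewrite -(ler_nat R) natrD card_ord; lra.
Qed.

(** Averaging gives an [a] helping a set [H] of at least [delta / 2 * #|D|] elements [r], by rules
    [{a, b} -> r]. If [b] is not yet spanned, some [d] in [D] covers it, and [d] is not [r] because
    [r] does not newly span [b]; with [a] added, [d] spans [r]. Shrinking removes half of [#|H|],
    whence [delta / 4]. *)
Lemma LCS_shrink A D :
  covers S A D ->
  (forall r, #|span S (r |: A) :\: span S A|%:R < delta * n%:R / 2) ->
  exists a D', covers S (a |: A) D' /\
    #|D'|%:R <= (1 - delta / 4) * #|D|%:R :> R.
Proof.
move=> cov light.
have [a leH] := @exists_dense_row R 'I_n 'I_n D _ _ (Ordinal n_gt0)
  (fun r _ => LCS_many_helpers (light r)).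
move: leH; set H := [set r in D | _] => leH.
have sHD : H \subset D by apply/subsetP => r; rewrite inE => /andP[].
have sA : A \subset a |: A := subsetUr _ _.
have [r rH|D' covD' leD'] := covers_shrink sHD (coversS sA cov).
  move: rH; rewrite inE => /andP[rD /existsP[b /andP[abS bC]]].
  have rb (T : {set 'I_n}) : a |: A \subset T -> b \in span S T -> r \in span S T.
    rewrite subUset sub1set => /andP[aT _] bT.
    by apply: span_rule abS; rewrite subUset !sub1set bT (subsetP (sub_span _ _)).
  case: (boolP (b \in span S A)) => [bA|bA].
    by left; apply: rb => //; apply: subsetP bA; apply: spanS.
  have /coversP/(_ b bA)[d dD bd] := cov.
  right; exists d.
    rewrite !inE dD andbT; apply: contraNneq bC => <-.
    by rewrite in_setD bA.
  apply: rb (subsetUr _ _) _; apply: subsetP bd; exact/spanS/setUS.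
exists a, D'; split=> //.
move: leD'; rewrite -(ler_nat R) natrD !natrM; lra.
Qed.

(** The bound is a potential: each added element is paid for by a drop of at least 1, in the second
    term if it enlarges the span a lot, in the logarithmic term otherwise. The last [1] pays for a
    step that empties [D]. *)
Lemma LCS_spanning_from A D :
  covers S A D -> (0 < #|D|)%N ->
  exists2 T, spanning S T &
    #|T|%:R <= #|A|%:R + 2 / delta * (1 - #|span S A|%:R / n%:R)
               + 4 / delta * ln #|D|%:R + 1.
Proof.
have nR_gt0 : 0 < n%:R :> R by rewrite ltr0n.
(* A heavy step lowers the first summand of this measure, a light step the second. *)
have [m] := ubnP (#|~: span S A| + #|D|)%N.
elim: m A D => // m IH A D; rewrite ltnS => le_m cov D_gt0.
have card_add a : #|a |: A|%:R <= #|A|%:R + 1 :> R.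
  by rewrite natr1 ler_nat cardsU1 -add1n leq_add2r leq_b1.
have sub_add a : span S A \subset span S (a |: A) by apply/spanS/subsetUr.
have card_compl a : (#|~: span S (a |: A)| <= #|~: span S A|)%N.
  by apply: subset_leq_card; rewrite setCS.
have D1 : 1 <= #|D|%:R :> R by rewrite ler1n.
have lnD : 0 <= ln #|D|%:R :> R by apply: ln_ge0.
have gap_ge0 (X : {set 'I_n}) : 0 <= 1 - #|X|%:R / n%:R :> R.
  by rewrite subr_ge0 ler_pdivrMr // mul1r ler_nat -[X in (_ <= X)%N]card_ord max_card.
case: (pselect (exists r, delta * n%:R / 2 <=
                 #|span S (r |: A) :\: span S A|%:R)) => [[r heavy]|no_heavy].
  have card_span : (#|span S (r |: A)| = #|span S A| + #|span S (r |: A) :\: span S A|)%N.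
    by rewrite -(cardsID (span S A) (span S (r |: A))) (setIidPr (sub_add r)).
  have gain_gt0 : (0 < #|span S (r |: A) :\: span S A|)%N.
    by rewrite -(ltr0n R); apply: lt_le_trans heavy; rewrite divr_gt0 ?mulr_gt0.
  have [|T spT leT] := IH (r |: A) D _ (coversS (subsetUr _ _) cov) D_gt0.
    apply: leq_trans le_m; rewrite ltn_add2r.
    rewrite -(ltn_add2l #|span S A|) cardsC card_ord.
    rewrite -[X in (_ < X)%N](card_ord n) -(cardsC (span S (r |: A))).
    by rewrite ltn_add2r card_span -[X in (X < _)%N]addn0 ltn_add2l.
  exists T => //; apply: (le_trans leT).
  rewrite !lerD2r card_span natrD.
  have : 1 <= 2 / delta * (#|span S (r |: A) :\: span S A|%:R / n%:R).
    rewrite mulrA ler_pdivlMr // mul1r mulrAC ler_pdivlMr //; lra.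
  rewrite (mulrDl _ _ n%:R^-1).
  have := card_add r; lra.
have light r : #|span S (r |: A) :\: span S A|%:R < delta * n%:R / 2.
  by rewrite ltNge; apply/negP => ?; apply: no_heavy; exists r.
have [a [D' [cov' leD']]] := LCS_shrink cov light.
have d4 : 0 < 1 - delta / 4 by have := LCS_delta_le1; lra.
case: (posnP #|D'|) => [/cards0_eq D'0|D'_gt0].
  exists (a |: A); first by apply: covers_set0; rewrite -D'0.
  apply: (le_trans (card_add a)); rewrite lerD2r -addrA lerDl.
  by rewrite addr_ge0 // mulr_ge0 // divr_ge0 // ltW.
have [|T spT leT] := IH (a |: A) D' _ cov' D'_gt0.
  apply: leq_trans le_m; rewrite -addnS leq_add // -(ltr_nat R).
  by apply: (le_lt_trans leD'); rewrite gtr_pMl ?ltr0n // gtrBl divr_gt0.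
exists T => //; apply: (le_trans leT); rewrite lerD2r.
have lnD' : ln #|D'|%:R <= ln #|D|%:R - delta / 4.
  have : ln #|D'|%:R <= ln ((1 - delta / 4) * #|D|%:R).
    by rewrite ler_ln ?posrE ?mulr_gt0 ?ltr0n.
  rewrite lnM ?posrE ?ltr0n //.
  have : ln (1 - delta / 4) <= - (delta / 4).
    by have := le_ln1Dx (x := - (delta / 4)); apply; lra.
  lra.
have : 4 / delta * ln #|D'|%:R <= 4 / delta * ln #|D|%:R - 1.
  have -> : 4 / delta * ln #|D|%:R - 1 = 4 / delta * (ln #|D|%:R - delta / 4).
    by field; rewrite gt_eqF.
  by rewrite ler_pM2l // divr_gt0.
have : 2 / delta * (1 - #|span S (a |: A)|%:R / n%:R) <=
       2 / delta * (1 - #|span S A|%:R / n%:R).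
  rewrite ler_pM2l ?divr_gt0 // lerD2l lerN2 ler_pM2r ?invr_gt0 // ler_nat.
  exact: subset_leq_card.
have := card_add a; lra.
Qed.

Lemma LCS_rank_le : (rank S)%:R <= 2 / delta + 4 / delta * ln n%:R + 1.
Proof.
have [|T spT leT] := LCS_spanning_from (covers_setT S).
  by rewrite cardsT card_ord.
have [_ /(_ T spT)] := rankP S; rewrite -(ler_nat R) => /le_trans; apply.
apply: (le_trans leT); rewrite cardsT card_ord cards0 add0r !lerD2r.
by apply: ler_piMr; [rewrite divr_ge0 // ltW | rewrite gerBl divr_ge0].
Qed.

End LCS.

Theorem mainTheorem1 (R : realType) :
  exists C : R, 0 < C /\
    forall (n : nat) (delta : R) (S : spanoid n),
      (2 <= n)%N -> 0 < delta -> is_LCS S 2 delta ->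
      (rank S)%:R <= C * (1 / delta) * log2 n%:R.
Proof.
(* Here 7 is 2 + 4 + 1: [1 / delta] and [log2 n] are at least 1, and [ln n <= log2 n] because
   [ln 2 <= 1]. *)
exists 7; split=> // n delta S n_ge2 delta_gt0 lcs.
have n_gt0 : (0 < n)%N := ltnW n_ge2.
apply: (le_trans (LCS_rank_le n_gt0 delta_gt0 lcs)).
have ln2_gt0 : 0 < ln 2 :> R by rewrite ln_gt0 // ltr1n.
have ln2_le1 : ln 2 <= 1 :> R by have := @le_ln1Dx R 1; apply; lra.
have log_ge1 : 1 <= log2 n%:R :> R.
  by rewrite /log2 ler_pdivlMr // mul1r ler_ln ?posrE ?ltr0n // ler_nat.
have ln_le : ln n%:R <= log2 n%:R :> R.
  have -> : ln n%:R = log2 n%:R * ln 2 :> R by rewrite /log2 mulfVK ?gt_eqF.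
  by rewrite ler_piMr // (le_trans ler01).
have inv_ge1 : 1 <= 1 / delta.
  by rewrite ler_pdivlMr // mul1r (LCS_delta_le1 n_gt0 lcs).
move: log_ge1 ln_le; set L := log2 _; set l := ln _; move=> log_ge1 ln_le.
have inv_gt0 : 0 < delta^-1 by rewrite invr_gt0.
move: inv_ge1 inv_gt0; rewrite mul1r; set u := delta^-1 => inv_ge1 inv_gt0.
nra.
Qed.
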